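(* If $f:\{-1,1\}^n\to\{-1,1\}$ is computable by a read-$k$ decision tree and $\mathcal{X}\sim\widehat f^2$, then $\mathbf{H}[\mathcal{X}]\le\left(2+(2k+2)\log_2 3\right)\cdot\mathbf{I}[f]$.
   Context: Fourier expansion under the uniform distribution; $\Pr[\mathcal{X}=S]=\widehat f(S)^2$; $\mathbf{H}[\mathcal{X}]=\sum_S\widehat f(S)^2\log_2(1/\widehat f(S)^2)$; $\mathbf{I}[f]=\sum_S|S|\widehat f(S)^2$. A decision tree is read-$k$ if no variable is queried at more than $k$ nodes. *)

(* Defs.v *)
From HB Require Import structures.
From mathcomp Require Import all_boot all_order all_algebra.
From mathcomp Require Import boolp classical_sets functions reals ereal.
From mathcomp Require Import exp measure.

Set Implicit Arguments.
Unset Strict Implicit.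
Unset Printing Implicit Defensive.

Import Order.TTheory GRing.Theory Num.Theory.
Local Open Scope ring_scope.

(* {-1,1} is represented by bool, via the bijection b |-> (-1) ^+ b, that is,
   false is 1 and true is -1. *)
Definition pm1 (R : realType) (b : bool) : R := (-1) ^+ b.

Definition cube (n : nat) := {ffun 'I_n -> bool}.

Definition parity (R : realType) (n : nat) (S : {set 'I_n}) (x : cube n) : R :=
  \prod_(i in S) pm1 R (x i).

Definition fourier (R : realType) (n : nat) (f : cube n -> bool)
    (S : {set 'I_n}) : R :=
  (\sum_(x : {ffun 'I_n -> bool}) pm1 R (f x) * parity R S x) / 2 ^+ n.

Definition total_influence (R : realType) (n : nat) (f : cube n -> bool) : R :=
  \sum_(S : {set 'I_n}) #|S|%:R * fourier R f S ^+ 2.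

Definition log2 (R : realType) (x : R) : R := ln x / ln 2.

Definition event_eq (T U : Type) (X : T -> U) (u : U) : set T :=
  fun t => X t = u.

Definition discrete_rv (d : measure_display) (T : measurableType d)
    (U : finType) (X : T -> U) : Prop :=
  forall u : U, measurable (event_eq X u).

Definition pr_eq (R : realType) (d : measure_display) (T : measurableType d)
    (P : probability T R) (U : finType) (X : T -> U) (u : U) : R :=
  fine (P (event_eq X u)).

(* Here 0 * log2 (1 / 0) = 0: inverse and logarithm are total. *)
Definition entropy (R : realType) (d : measure_display) (T : measurableType d)
    (P : probability T R) (U : finType) (X : T -> U) : R :=
  \sum_(u : U) pr_eq P X u * log2 (1 / pr_eq P X u).

Definition spectral_sample (R : realType) (d : measure_display)
    (T : measurableType d) (P : probability T R) (n : nat)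
    (f : cube n -> bool) (X : T -> {set 'I_n}) : Prop :=
  discrete_rv X /\ forall S : {set 'I_n}, pr_eq P X S = fourier R f S ^+ 2.

(* In [Query i t0 t1], t0 is taken when x_i = 1 and t1 when x_i = -1.  A
   variable may be queried again further down a path. *)
Inductive dtree (n : nat) : Type :=
| Leaf of bool
| Query of 'I_n & dtree n & dtree n.

Fixpoint dtree_eval (n : nat) (t : dtree n) (x : cube n) : bool :=
  match t with
  | Leaf b => b
  | Query i t0 t1 => if x i then dtree_eval t1 x else dtree_eval t0 x
  end.

Fixpoint query_count (n : nat) (t : dtree n) (i : 'I_n) : nat :=
  match t with
  | Leaf _ => 0%N
  | Query j t0 t1 => ((j == i) + query_count t0 i + query_count t1 i)%N
  end.

Definition read_k (n k : nat) (t : dtree n) : Prop :=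
  forall i : 'I_n, (query_count t i <= k)%N.

Definition computes (n : nat) (t : dtree n) (f : cube n -> bool) : Prop :=
  forall x : cube n, dtree_eval t x = f x.

(* Main.v *)
Require Import Defs.
From HB Require Import structures.
From mathcomp Require Import all_boot all_order all_algebra.
From mathcomp Require Import boolp classical_sets functions reals ereal.
From mathcomp Require Import exp measure.
From mathcomp Require Import finset zify ring lra.

Import Order.TTheory GRing.Theory Num.Theory.
Local Open Scope ring_scope.

(** Let S be drawn from the squared Fourier coefficients of f.  After pruning,
    no path of the tree repeats a variable, so querying i at the root, with
    subtrees computing f0 and f1, gives for i not in S
    f^(S) = (f0^(S) + f1^(S)) / 2  and  f^(S + i) = (f0^(S) - f1^(S)) / 2.
    A nonempty S is thus encoded by walking down the tree until all of S has
    been met, naming at each node one of at most nine outcomes.  A step at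
    which only one of f0^(S), f1^(S) is nonzero puts i into S with probability
    1/2, so such steps are paid for by 2 |S|; a step at which both are nonzero
    requires every variable of S to occur in both subtrees, which lowers the
    number of occurrences below the current node, so there are fewer than k of
    them.  Hence the expected number of steps is at most (k + 1) I[f], each
    costing log2 9 bits.  Finally, telling whether S is empty costs at most
    2 I[f] bits, by the edge-isoperimetric inequality. *)

(** * Parity characters and Parseval's identity *)

Lemma pm1_sqr (R : realType) (b : bool) : pm1 R b * pm1 R b = 1.
Proof. by case: b; rewrite /pm1 /= ?expr1 ?expr0 ?mulrNN mulr1. Qed.

Lemma pm1E (R : realType) (b : bool) : pm1 R b = if b then -1 else 1.
Proof. by case: b. Qed.

Lemma parityU1 (R : realType) (n : nat) (i : 'I_n) (S : {set 'I_n})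
    (x : cube n) :
  i \notin S -> parity R (i |: S) x = pm1 R (x i) * parity R S x.
Proof. by move=> iS; rewrite /parity big_setU1. Qed.

(** The sum over [S] expands the product over coordinates of [x_i y_i + 1], whose factors are 2
    where [x] and [y] agree and 0 elsewhere. *)
Lemma sum_parity (R : realType) (n : nat) (x y : cube n) :
  \sum_(S : {set 'I_n}) parity R S x * parity R S y =
  if x == y then 2 ^+ n else 0.
Proof.
transitivity (\prod_(i < n) (pm1 R (x i) * pm1 R (y i) + 1)).
  rewrite bigA_distr; apply: eq_bigr => S _.
  by rewrite /parity -big_split big_mkcond.
case: eqVneq => [<-|/eqP xy].
  under eq_bigr do rewrite pm1_sqr.
  by rewrite prodr_const card_ord.
have [i xyi] : exists i, x i != y i.
  apply/existsP; apply: contra_notT xy; rewrite negb_exists => /forallP xy.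
  by apply/ffunP => i; apply/eqP; have := xy i; rewrite negbK.
rewrite (bigD1 i) //= !pm1E.
by move: xyi; case: (x i); case: (y i) => //= _; rewrite ?mulN1r ?mulrN1 addNr mul0r.
Qed.

(** Real-valued [g] is allowed so that it also applies to a difference of two Boolean functions. *)
Lemma parseval (R : realType) (n : nat) (g : cube n -> R) :
  \sum_(S : {set 'I_n}) ((\sum_x g x * parity R S x) / 2 ^+ n) ^+ 2 =
  (\sum_x g x ^+ 2) / 2 ^+ n.
Proof.
have n2 : (2 : R) ^+ n != 0 by rewrite expf_neq0 // pnatr_eq0.
transitivity ((\sum_x \sum_y g x * g y *
    \sum_(S : {set 'I_n}) parity R S x * parity R S y) / (2 ^+ n * 2 ^+ n)).
  rewrite mulr_suml.
  under eq_bigr => S _.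
    rewrite expr2 mulf_div big_distrlr /= mulr_suml.
    under eq_bigr do rewrite mulr_suml.
    over.
  rewrite exchange_big /=; apply: eq_bigr => x _.
  rewrite mulr_suml exchange_big /=; apply: eq_bigr => y _.
  rewrite -mulrA mulr_suml mulr_sumr; apply: eq_bigr => S _; ring.
transitivity ((\sum_x g x ^+ 2) * 2 ^+ n / (2 ^+ n * 2 ^+ n)); last by field.
congr (_ / _); rewrite mulr_suml; apply: eq_bigr => x _.
rewrite (bigD1 x) //= sum_parity eqxx big1 ?addr0 ?expr2 // => y yx.
by rewrite sum_parity eq_sym (negPf yx) mulr0.
Qed.

Lemma sum_fourier_sqr (R : realType) (n : nat) (f : cube n -> bool) :
  \sum_(S : {set 'I_n}) fourier R f S ^+ 2 = 1.
Proof.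
rewrite parseval; under eq_bigr do rewrite expr2 pm1_sqr.
by rewrite sumr_const card_ffun card_bool card_ord natrX divff // expf_neq0 // pnatr_eq0.
Qed.

(* The right-hand side is 4 Pr[f != g]. *)
Lemma sum_fourierB_sqr_ge (R : realType) (n : nat) (f g : cube n -> bool) :
  2 * `|fourier R f set0 - fourier R g set0| <=
  \sum_(S : {set 'I_n}) (fourier R f S - fourier R g S) ^+ 2.
Proof.
have fB S : fourier R f S - fourier R g S =
    (\sum_x (pm1 R (f x) - pm1 R (g x)) * parity R S x) / 2 ^+ n.
  rewrite /fourier -mulrBl -sumrB; congr (_ / _).
  by apply: eq_bigr => x _; rewrite mulrBl.
under eq_bigr do rewrite fB.
rewrite parseval fB normrM normfV normrX (ger0_norm (ler0n R 2)) mulrA.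
rewrite ler_pM2r ?invr_gt0 ?exprn_gt0 ?ltr0n //.
apply: (@le_trans _ _ (2 * \sum_x `|pm1 R (f x) - pm1 R (g x)|)).
  rewrite ler_pM2l ?ltr0n //; apply: le_trans (ler_norm_sum _ _ _) _.
  by apply: ler_sum => x _; rewrite /parity big_set0 mulr1.
(* Pointwise the difference is 0, 2 or -2, so its square is twice its absolute value. *)
rewrite mulr_sumr; apply: ler_sum => x _; rewrite !pm1E.
case: (f x); case: (g x); rewrite ?subrr ?normr0 ?mulr0 ?expr0n //.
  by rewrite ler0_norm; lra.
by rewrite ger0_norm; lra.
Qed.

(** * Fourier coefficients under branching *)

(** Flipping coordinate [j] preserves [f] and negates the parity of [S], so the sum equals its own
    opposite. *)
Lemma fourier_indep (R : realType) (n : nat) (f : cube n -> bool) (j : 'I_n)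
    (S : {set 'I_n}) :
  (forall x y : cube n, (forall i, i != j -> x i = y i) -> f x = f y) ->
  j \in S -> fourier R f S = 0.
Proof.
move=> fj jS.
pose flip (x : cube n) : cube n := [ffun i => (i == j) (+) x i].
have flipK : involutive flip.
  by move=> x; apply/ffunP => i; rewrite !ffunE addbA addbb.
rewrite /fourier; set s := (\sum_x _); suff -> : s = 0 by rewrite mul0r.
suff : s = - s by move=> ?; lra.
rewrite {1}/s (reindex_inj (inv_inj flipK)) -sumrN; apply: eq_bigr => x _.
rewrite (fj (flip x) x) => [|i ij]; last by rewrite ffunE (negPf ij).
rewrite -(setD1K jS) !parityU1 ?setD11 // ffunE eqxx /=.
have -> : parity R (S :\ j) (flip x) = parity R (S :\ j) x.
  by apply: eq_bigr => i /setD1P[ij _]; rewrite ffunE (negPf ij).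
by rewrite !pm1E; case: (x j) => /=; ring.
Qed.

(** In signs, f = (1 + x_i)/2 f0 + (1 - x_i)/2 f1. Multiplying by x_i exchanges the coefficients at
    [S] and [i |: S], and those of f0 and f1 at [i |: S] vanish. *)
Lemma fourier_branch (R : realType) (n : nat) (i : 'I_n)
    (f f0 f1 : cube n -> bool) (S : {set 'I_n}) :
  (forall x, f x = if x i then f1 x else f0 x) -> i \notin S ->
  fourier R f0 (i |: S) = 0 -> fourier R f1 (i |: S) = 0 ->
  fourier R f S = (fourier R f0 S + fourier R f1 S) / 2 /\
  fourier R f (i |: S) = (fourier R f0 S - fourier R f1 S) / 2.
Proof.
move=> fE iS; rewrite /fourier => h0 h1.
have n2 : (2 : R) ^+ n != 0 by rewrite expf_neq0 // pnatr_eq0.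
set A := \sum_x pm1 R (f0 x) * parity R S x.
set B := \sum_x pm1 R (f1 x) * parity R S x.
set A' := \sum_x pm1 R (f0 x) * parity R (i |: S) x in h0 *.
set B' := \sum_x pm1 R (f1 x) * parity R (i |: S) x in h1 *.
have A0 : A' = 0 by rewrite -(divfK n2 A') h0 mul0r.
have B0 : B' = 0 by rewrite -(divfK n2 B') h1 mul0r.
have -> : \sum_x pm1 R (f x) * parity R S x = (A + B + A' - B') / 2.
  rewrite /A /B /A' /B' -!big_split /= -sumrB mulr_suml.
  apply: eq_bigr => x _; rewrite fE parityU1 // !pm1E.
  by case: (x i); field.
have -> : \sum_x pm1 R (f x) * parity R (i |: S) x = (A - B + A' + B') / 2.
  rewrite /A /B /A' /B' -sumrB -!big_split /= mulr_suml.
  apply: eq_bigr => x _; rewrite fE parityU1 // !pm1E.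
  by case: (x i); field.
by rewrite A0 B0; split; field.
Qed.

Lemma big_set_split (R : realType) (n : nat) (i : 'I_n)
    (g : {set 'I_n} -> R) :
  \sum_S g S = \sum_(S : {set 'I_n} | i \notin S) (g S + g (i |: S)).
Proof.
rewrite (bigID (fun S : {set 'I_n} => i \notin S)) /= big_split; congr (_ + _).
rewrite (reindex_onto (fun S => i |: S) (fun S => S :\ i)) /=; last first.
  by move=> S; rewrite negbK => /setD1K.
apply: eq_bigl => S; rewrite negbK setU11 /=.
apply/eqP/idP => [<-|/setU1K //]; by rewrite setD11.
Qed.

Lemma query_count0_indep (n : nat) (t : dtree n) (j : 'I_n) (x y : cube n) :
  query_count t j = 0%N -> (forall i, i != j -> x i = y i) ->
  dtree_eval t x = dtree_eval t y.
Proof.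
move=> + xy; elim: t => //= i t0 IH0 t1 IH1.
case: eqVneq => [//|ij] /eqP; rewrite add0n addn_eq0 => /andP[/eqP h0 /eqP h1].
by rewrite xy // IH0 // IH1.
Qed.

Lemma fourier_support (R : realType) (n : nat) (t : dtree n) (j : 'I_n)
    (S : {set 'I_n}) :
  j \in S -> query_count t j = 0%N -> fourier R (dtree_eval t) S = 0.
Proof.
by move=> jS tj; apply: (fourier_indep R n _ j) => // x y; apply: query_count0_indep.
Qed.

(** * Pruning repeated queries *)

Fixpoint irredundant {n : nat} (t : dtree n) : Prop :=
  match t with
  | Leaf _ => True
  | Query i t0 t1 => [/\ query_count t0 i = 0%N, query_count t1 i = 0%N,
      irredundant t0 & irredundant t1]
  end.

(** [rho] holds the answers already given on the path from the root; a query it answers is replaced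
    by the branch that is forced. *)
Fixpoint prune {n : nat} (rho : 'I_n -> option bool) (t : dtree n) : dtree n :=
  match t with
  | Leaf b => Leaf n b
  | Query i t0 t1 =>
      match rho i with
      | Some b => if b then prune rho t1 else prune rho t0
      | None => Query i
          (prune (fun j => if j == i then Some false else rho j) t0)
          (prune (fun j => if j == i then Some true else rho j) t1)
      end
  end.

Lemma prune_eval (n : nat) (t : dtree n) (rho : 'I_n -> option bool)
    (x : cube n) :
  (forall i b, rho i = Some b -> x i = b) ->
  dtree_eval (prune rho t) x = dtree_eval t x.
Proof.
elim: t rho => //= i t0 IH0 t1 IH1 rho rx.
case E: (rho i) => [b|] /=.
  by rewrite (rx _ _ E); case: b {E} => /=; auto.
case xi: (x i); [apply: IH1|apply: IH0] => j b.
  by case: eqVneq => [-> [<-]|_ /rx].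
by case: eqVneq => [-> [<-]|_ /rx].
Qed.

Lemma prune_count_le (n : nat) (t : dtree n) (rho : 'I_n -> option bool)
    (j : 'I_n) : (query_count (prune rho t) j <= query_count t j)%N.
Proof.
elim: t rho => //= i t0 IH0 t1 IH1 rho.
case: (rho i) => [[]|] /=.
- by have := IH1 rho; lia.
- by have := IH0 rho; lia.
- by rewrite !leq_add.
Qed.

Lemma prune_count0 (n : nat) (t : dtree n) (rho : 'I_n -> option bool)
    (j : 'I_n) : rho j -> query_count (prune rho t) j = 0%N.
Proof.
elim: t rho => //= i t0 IH0 t1 IH1 rho rj.
case E: (rho i) => [[]|] /=; auto.
have ij : (i == j) = false by apply/eqP => ij; rewrite -ij E in rj.
by rewrite ij IH0 ?IH1 // eq_sym ij.
Qed.

Lemma prune_irredundant (n : nat) (t : dtree n) (rho : 'I_n -> option bool) :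
  irredundant (prune rho t).
Proof.
elim: t rho => //= i t0 IH0 t1 IH1 rho.
by case: (rho i) => [[]|] //=; split=> //; apply: prune_count0; rewrite eqxx.
Qed.

Lemma fourier_query (R : realType) (n : nat) (i : 'I_n) (t0 t1 : dtree n)
    (S : {set 'I_n}) :
  irredundant (Query i t0 t1) -> i \notin S ->
  fourier R (dtree_eval (Query i t0 t1)) S =
    (fourier R (dtree_eval t0) S + fourier R (dtree_eval t1) S) / 2 /\
  fourier R (dtree_eval (Query i t0 t1)) (i |: S) =
    (fourier R (dtree_eval t0) S - fourier R (dtree_eval t1) S) / 2.
Proof.
move=> [c0 c1 _ _] iS; apply: fourier_branch => //.
- by apply: (fourier_support R n _ i); rewrite ?setU11.
- by apply: (fourier_support R n _ i); rewrite ?setU11.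
Qed.

(** * Inequalities for x ln x *)

(** This is ln(y/x) <= y/x - 1 multiplied by [x]. Allowing [x = 0] lets it be summed as Gibbs'
    inequality over distributions with zero masses. *)
Lemma mul_ln_le (R : realType) (x y : R) :
  0 <= x -> 0 <= y -> (x != 0 -> 0 < y) -> x * ln y <= x * ln x + y - x.
Proof.
move=> x0 y0 xy; have [->|xN0] := eqVneq x 0; first by rewrite !mul0r; lra.
have {}x0 : 0 < x by rewrite lt_def xN0.
have {}y0 := xy xN0.
have : ln (1 + (y / x - 1)) <= y / x - 1.
  by apply: le_ln1Dx; have : 0 < y / x by [exact: divr_gt0]; lra.
rewrite addrC subrK ln_div // => /(ler_wpM2l (ltW x0)).
rewrite !mulrBr mulr1 mulrCA divff // mulr1; lra.
Qed.

Lemma ln2_ge_half (R : realType) : 1 / 2 <= ln 2 :> R.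
Proof. have := @mul_ln_le R 2 1; rewrite ln1; lra. Qed.

(** The two-point inequality behind the induction for edge isoperimetry. It is tight both at [a = b]
    and at [a = 0], which fixes the constant [ln 2]. *)
Lemma mul_ln_midpoint (R : realType) (a b : R) : 0 <= a -> 0 <= b ->
  - (2 * ((a + b) / 2) * ln ((a + b) / 2)) <=
  ln 2 * `|a - b| - a * ln a - b * ln b.
Proof.
wlog ab : a b / a <= b.
  move=> H a0 b0; have [/H|/ltW ba] := leP a b; first exact.
  by have := H b a ba b0 a0; rewrite [a + b]addrC distrC; lra.
move=> a0 _; rewrite ler0_norm; last lra.
set m := (a + b) / 2; have mE : 2 * m = a + b by rewrite /m; field.
clearbody m.
have [b0|b0] := eqVneq b 0.
  have a00 : a = 0 by lra.
  have -> : m = 0 by lra.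
  by rewrite a00 b0 !mul0r !mulr0; lra.
have {}b0 : 0 < b by rewrite lt_def b0; lra.
have m0 : 0 < m by lra.
have h1 : a * ln a <= a * ln m.
  have [->|aN0] := eqVneq a 0; first by rewrite !mul0r.
  have {}a0 : 0 < a by rewrite lt_def aN0.
  by rewrite ler_pM2l // ler_ln ?posrE //; lra.
suff h2 : b * ln b <= ln 2 * (b - a) + b * ln m.
  by rewrite mE mulrDl; lra.
(* b lies between m and 2m, so b ln b is below the chord of x ln x there. *)
have t1 : m * ln b <= m * ln m + b - m by apply: mul_ln_le => //; lra.
have t2 : 2 * m * ln b <= 2 * m * ln (2 * m) + b - 2 * m.
  by apply: mul_ln_le => //; lra.
rewrite lnM ?posrE ?ltr0n // in t2.
have bm : 0 <= b - m by lra.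
(* With weights [a = 2m - b] and [b - m] the left sides add up to m b ln b, and the non-logarithmic
   remainders cancel. *)
have t := lerD (ler_wpM2l a0 t1) (ler_wpM2l bm t2).
have aE : a = 2 * m - b by lra.
rewrite aE in t *; rewrite -(ler_pM2l m0); lra.
Qed.

(** If a Boolean function takes its rarer value with probability [b], its squared mean is (1 -
    2b)^2. So the entropy of the event that S is empty is at most twice the left side of
    [edge_isoperimetric]. *)
Lemma binary_entropy_le (R : realType) (b : R) : 0 <= b -> 2 * b <= 1 ->
  - ((1 - (1 - 2 * b) ^+ 2) * ln (1 - (1 - 2 * b) ^+ 2))
    - (1 - 2 * b) ^+ 2 * ln ((1 - 2 * b) ^+ 2) <= - (4 * b * ln b).
Proof.
move=> b0 b1; have l2 := ln2_ge_half R.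
have [->|bN0] := eqVneq b 0.
  by rewrite !mulr0 subr0 expr1n subrr ln1 !mul0r; lra.
have {}b0 : 0 < b by rewrite lt_def bN0.
have lb : ln b <= 0 by apply: ln_le0; lra.
have [mE|mN0] := eqVneq (1 - 2 * b) 0.
  rewrite mE expr0n subr0 ln1 mulr0 mul0r.
  have : b * ln b <= 0 by rewrite pmulr_rle0.
  lra.
have m0 : 0 < 1 - 2 * b by rewrite lt_def mN0; lra.
have -> : 1 - (1 - 2 * b) ^+ 2 = 2 * 2 * (b * (1 - b)) by ring.
have b1' : 0 < 1 - b by lra.
rewrite lnXn // !lnM ?posrE ?mulr_gt0 //.
have t1 := @mul_ln_le R (1 - 2 * b) 1 (ltW m0) ler01 (fun _ => ltr01).
have t2 := @mul_ln_le R (1 - b) 1 (ltW b1') ler01 (fun _ => ltr01).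
rewrite ln1 in t1 t2.
have {}t1 := ler_wpM2l (ltW m0) t1.
have {}t2 := ler_wpM2l (ltW b0) t2.
(* The tangent bounds [t1] and [t2] cost 4b(1 - b) in total, which the term 8b(1 - b) ln 2 covers
   since ln 2 >= 1/2. *)
have t3 : 0 <= b * (1 - b) * (ln 2 - 1 / 2) by rewrite !mulr_ge0 //; lra.
have t4 : b ^+ 2 * ln b <= 0 by rewrite pmulr_rle0 // exprn_gt0.
lra.
Qed.

(** * Influence along a tree and edge isoperimetry *)

(** By the parallelogram law each pair [S], [i |: S] carries the average squared mass of the
    children. The last term is the influence of [i], from the extra element of [i |: S]. *)
Lemma total_influence_query (R : realType) (n : nat) (i : 'I_n)
    (t0 t1 : dtree n) :
  irredundant (Query i t0 t1) ->
  total_influence R (dtree_eval (Query i t0 t1)) =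
  (total_influence R (dtree_eval t0) + total_influence R (dtree_eval t1)) / 2 +
  (\sum_S (fourier R (dtree_eval t0) S - fourier R (dtree_eval t1) S) ^+ 2) / 4.
Proof.
move=> irr; have [c0 c1 _ _] := irr.
rewrite /total_influence -big_split /= !mulr_suml -big_split /=.
rewrite !(big_set_split _ _ i); apply: eq_bigr => S iS.
have [-> ->] := fourier_query R n i t0 t1 S irr iS.
rewrite (fourier_support R n t0 i (i |: S)) ?setU11 //.
rewrite (fourier_support R n t1 i (i |: S)) ?setU11 //.
by rewrite cardsU1 iS add1n -natr1; field.
Qed.

Lemma fourier_leaf (R : realType) (n : nat) (b : bool) :
  fourier R (dtree_eval (Leaf n b)) set0 = pm1 R b.
Proof.
rewrite /fourier; under eq_bigr do rewrite /parity big_set0 mulr1 /=.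
rewrite sumr_const card_ffun card_bool card_ord -[X in X / _]mulr_natr natrX.
by rewrite mulfK // expf_neq0 // pnatr_eq0.
Qed.

Lemma total_influence_ge0 (R : realType) (n : nat) (f : cube n -> bool) :
  0 <= total_influence R f.
Proof. by apply: sumr_ge0 => S _; rewrite mulr_ge0 ?sqr_ge0. Qed.

Lemma fourier_le1 (R : realType) (n : nat) (f : cube n -> bool)
    (S : {set 'I_n}) : `|fourier R f S| <= 1.
Proof.
rewrite -(@ler_pXn2r _ 2) ?nnegrE // expr1n real_normK ?num_real //.
rewrite -(sum_fourier_sqr R n f) (bigD1 S) //= lerDl.
by apply: sumr_ge0 => ? _; apply: sqr_ge0.
Qed.

(* The edge-isoperimetric inequality; (1 + pm1 e * fourier f set0) / 2 is the
   probability that f takes the value e. *)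
Lemma edge_isoperimetric (R : realType) (n : nat) (t : dtree n) (e : bool) :
  irredundant t ->
  let b := (1 + pm1 R e * fourier R (dtree_eval t) set0) / 2 in
  - (2 * b * ln b) <= ln 2 * total_influence R (dtree_eval t).
Proof.
have l2 := ln2_ge_half R.
elim: t => [c _|i t0 IH0 t1 IH1 irr] /=.
  have : 0 <= ln 2 * total_influence R (dtree_eval (Leaf n c)).
    by rewrite mulr_ge0 ?total_influence_ge0 //; lra.
  rewrite fourier_leaf; apply: le_trans.
  have [->|->] : (1 + pm1 R e * pm1 R c) / 2 = 0 \/ (1 + pm1 R e * pm1 R c) / 2 = 1.
    by rewrite !pm1E; case: c; case: e; [right|left|left|right]; lra.
  - by rewrite mulr0 mul0r oppr0.
  - by rewrite ln1 mulr0 oppr0.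
have [_ _ /IH0 /= {}IH0 /IH1 /= {}IH1] := irr.
rewrite total_influence_query //.
have := sum_fourierB_sqr_ge R n (dtree_eval t0) (dtree_eval t1).
set Q := \sum_S _ => hQ.
have [-> _] := fourier_query R n i t0 t1 set0 irr (negbT (in_set0 i)).
move: IH0 IH1 hQ.
have m0 := fourier_le1 R n (dtree_eval t0) set0.
have m1 := fourier_le1 R n (dtree_eval t1) set0.
set u := fourier R _ set0 in m0 *; set v := fourier R _ set0 in m1 *.
set I0 := total_influence _ _; set I1 := total_influence _ _.
set b0 := (1 + _ * u) / 2; set b1 := (1 + _ * v) / 2 => IH0 IH1 hQ.
have b0_ge0 : 0 <= b0.
  by rewrite /b0; move: m0; rewrite ler_norml pm1E => /andP[]; case: e {b0 b1 IH0 IH1}; lra.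
have b1_ge0 : 0 <= b1.
  by rewrite /b1; move: m1; rewrite ler_norml pm1E => /andP[]; case: e {b0 b1 IH0 IH1 b0_ge0}; lra.
have -> : (1 + pm1 R e * ((u + v) / 2)) / 2 = (b0 + b1) / 2.
  by rewrite /b0 /b1; field.
have bd : `|b0 - b1| = `|u - v| / 2.
  have -> : b0 - b1 = pm1 R e * (u - v) / 2 by rewrite /b0 /b1; field.
  rewrite !normrM /pm1 normrX normrN1 expr1n mul1r normfV.
  by rewrite (ger0_norm (ler0n R 2)).
(* The midpoint inequality costs ln 2 |b0 - b1| = ln 2 |u - v| / 2, and the influence of the root,
   [Q / 4], is at least |u - v| / 2. *)
have mid := mul_ln_midpoint R b0 b1 b0_ge0 b1_ge0; rewrite bd in mid.
have l20 : 0 <= ln 2 :> R by lra.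
have := ler_wpM2l l20 hQ; lra.
Qed.

(** * Weights of walk codes *)

(* The sum of 9 ^ (- number of steps) over all walks encoding S. *)
Fixpoint path_weight (R : realType) {n : nat} (t : dtree n)
    (S : {set 'I_n}) : R :=
  match t with
  | Leaf _ => 0
  | Query i t0 t1 =>
      if S == set0 then 0
      else ((S == [set i])%:R + path_weight R t0 (S :\ i) +
            path_weight R t1 (S :\ i)) / 9
  end.

Lemma path_weight_ge0 (R : realType) (n : nat) (t : dtree n) (S : {set 'I_n}) :
  0 <= path_weight R t S.
Proof.
elim: t S => //= i t0 IH0 t1 IH1 S; case: ifP => // _.
by rewrite divr_ge0 ?addr_ge0.
Qed.

Lemma path_weight_set0 (R : realType) (n : nat) (t : dtree n) : path_weight R t set0 = 0.
Proof. by case: t => //= *; rewrite eqxx. Qed.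

Lemma path_weight_query (R : realType) (n : nat) (i : 'I_n) (t0 t1 : dtree n)
    (S : {set 'I_n}) : i \notin S -> S != set0 ->
  path_weight R (Query i t0 t1) S = (path_weight R t0 S + path_weight R t1 S) / 9.
Proof.
move=> iS SN0 /=; rewrite (negPf SN0).
have -> : S :\ i = S by apply/setDidPl; rewrite disjoint_sym disjoints1.
suff -> : (S == [set i]) = false by rewrite add0r.
by apply: contraNF iS => /eqP ->; rewrite set11.
Qed.

Lemma path_weight_queryU1 (R : realType) (n : nat) (i : 'I_n) (t0 t1 : dtree n)
    (S : {set 'I_n}) : i \notin S ->
  path_weight R (Query i t0 t1) (i |: S) =
  ((S == set0)%:R + path_weight R t0 S + path_weight R t1 S) / 9.
Proof.
move=> iS /=; rewrite setU1K //.
have -> : (i |: S == set0) = false.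
  by apply/negbTE/set0Pn; exists i; rewrite setU11.
suff -> : (i |: S == [set i]) = (S == set0) by [].
apply/eqP/eqP => [h|->]; last by rewrite setU0.
by rewrite -(setU1K iS) h setDv.
Qed.

(** A Kraft inequality. At a query the walk either stops, or chooses a child and whether [i] is in
    S, so by induction the sum is at most (1 + 2 + 2)/9. *)
Lemma sum_path_weight_le1 (R : realType) (n : nat) (t : dtree n) :
  \sum_S path_weight R t S <= 1.
Proof.
elim: t => [b|i t0 IH0 t1 IH1]; first by rewrite big1 ?ler01.
rewrite (big_set_split _ _ i).
apply: (@le_trans _ _ (\sum_(S : {set 'I_n})
    ((S == set0)%:R + 2 * path_weight R t0 S + 2 * path_weight R t1 S) / 9)).
  rewrite [leRHS](bigID (fun S : {set 'I_n} => i \notin S)) ler_wpDr //.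
    by apply: sumr_ge0 => S _; rewrite divr_ge0 ?addr_ge0 ?mulr_ge0 ?path_weight_ge0.
  apply: ler_sum => S iS; rewrite path_weight_queryU1 //.
  have [->|SN0] := eqVneq S set0; first by rewrite !path_weight_set0; lra.
  by rewrite path_weight_query //; lra.
rewrite -mulr_suml !big_split /= -!mulr_sumr.
have -> : \sum_(S : {set 'I_n}) (S == set0)%:R = 1 :> R.
  by rewrite (bigD1 set0) //= eqxx big1 ?addr0 // => S /negPf ->.
lra.
Qed.

Lemma query_count_gt0 (R : realType) (n : nat) (t : dtree n) (S : {set 'I_n})
    (j : 'I_n) :
  fourier R (dtree_eval t) S != 0 -> j \in S -> (0 < query_count t j)%N.
Proof.
move=> FN0 jS; rewrite lt0n; apply: contraNneq FN0 => /(fourier_support R n t j S jS) ->.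
by [].
Qed.

(** At each query some child keeps a nonzero coefficient, so a walk encoding [S] exists. This keeps
    [ln (path_weight R t S)] away from [ln 0] wherever it has positive mass. *)
Lemma path_weight_gt0 (R : realType) (n : nat) (t : dtree n) (S : {set 'I_n}) :
  irredundant t -> S != set0 -> fourier R (dtree_eval t) S != 0 ->
  0 < path_weight R t S.
Proof.
elim: t S => [b S _ /set0Pn[j jS] /query_count_gt0 /(_ jS) //|].
move=> i t0 IH0 t1 IH1 S irr SN0; have [_ _ irr0 irr1] := irr.
have pos S' : S' != set0 ->
    fourier R (dtree_eval t0) S' != 0 \/ fourier R (dtree_eval t1) S' != 0 ->
    0 < path_weight R t0 S' + path_weight R t1 S'.
  move=> S'N0 [F0|F1].
    by rewrite ltr_pwDl ?path_weight_ge0 // IH0.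
  by rewrite addrC ltr_pwDl ?path_weight_ge0 // IH1.
have [iS|iS] := boolP (i \in S); last first.
  have [-> _] := fourier_query R n i t0 t1 S irr iS.
  move=> FN0; rewrite path_weight_query // divr_gt0 ?ltr0n //; apply: pos => //.
  have [F0|] := eqVneq (fourier R (dtree_eval t0) S) 0; last by left.
  by right; apply: contraNneq FN0 => F1; rewrite F0 F1 addr0 mul0r.
have iS' : i \notin S :\ i by rewrite setD11.
rewrite -(setD1K iS); have [_ ->] := fourier_query R n i t0 t1 _ irr iS'.
move=> FN0; rewrite path_weight_queryU1 // divr_gt0 ?ltr0n // -addrA.
have [->|S'N0] := eqVneq (S :\ i) set0.
  by rewrite !path_weight_set0 !addr0 ltr01.
rewrite add0r; apply: pos => //.
have [F0|] := eqVneq (fourier R (dtree_eval t0) (S :\ i)) 0; last by left.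
by right; apply: contraNneq FN0 => F1; rewrite F0 F1 subr0 mul0r.
Qed.

(** * The potential bounding the expected code length *)

Definition max_count {n : nat} (t : dtree n) (S : {set 'I_n}) : nat :=
  \max_(j in S) query_count t j.

Lemma max_count_gt0 (R : realType) (n : nat) (t : dtree n) (S : {set 'I_n}) :
  S != set0 -> fourier R (dtree_eval t) S != 0 -> (0 < max_count t S)%N.
Proof.
move=> /set0Pn[j jS] FN0; apply: leq_trans (query_count_gt0 R n t S j FN0 jS) _.
by rewrite /max_count (bigD1 j) //= leq_maxl.
Qed.

Lemma max_count_child (n : nat) (i : 'I_n) (t0 t1 : dtree n) (S : {set 'I_n}) :
  (max_count t0 S <= max_count (Query i t0 t1) S)%N /\
  (max_count t1 S <= max_count (Query i t0 t1) S)%N.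
Proof.
by split; apply/bigmax_leqP => j jS; rewrite /max_count (bigD1 j) //=;
  apply: leq_trans (leq_maxl _ _); lia.
Qed.

(** Every variable of [S] occurs in both subtrees, so a variable attaining the maximum in one
    subtree gains at least one occurrence from the other. *)
Lemma max_count_drop (R : realType) (n : nat) (i : 'I_n) (t0 t1 : dtree n)
    (S : {set 'I_n}) :
  S != set0 -> fourier R (dtree_eval t0) S != 0 ->
  fourier R (dtree_eval t1) S != 0 ->
  (max_count t0 S < max_count (Query i t0 t1) S)%N /\
  (max_count t1 S < max_count (Query i t0 t1) S)%N.
Proof.
move=> SN0 F0 F1.
have S0 : (0 < #|S|)%N by rewrite card_gt0.
split; rewrite /max_count.
  have [j jS ->] := eq_bigmax_cond (query_count t0) S0.
  have c1 := query_count_gt0 R n t1 S j F1 jS.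
  by rewrite (bigD1 j) //=; apply: leq_trans (leq_maxl _ _); lia.
have [j jS ->] := eq_bigmax_cond (query_count t1) S0.
have c0 := query_count_gt0 R n t0 S j F0 jS.
by rewrite (bigD1 j) //=; apply: leq_trans (leq_maxl _ _); lia.
Qed.

(* The potential 2 #|S| - 2 + max_count t S dominates the expected number of
   steps of the walk; slack compares it with the length of the code. *)
Definition slack (R : realType) {n : nat} (t : dtree n) (S : {set 'I_n}) : R :=
  if S == set0 then 0 else fourier R (dtree_eval t) S ^+ 2 *
    (ln 9 * (2 * #|S|%:R - 2 + (max_count t S)%:R) + ln (path_weight R t S)).

(** Taking one step multiplies the weight by no less than 1/9, a cost of [ln 9]; the potential falls
    on average by at least 1 to pay for it. *)
Lemma slack_query (R : realType) (n : nat) (i : 'I_n) (t0 t1 : dtree n)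
    (S : {set 'I_n}) :
  irredundant (Query i t0 t1) -> i \notin S ->
  (slack R t0 S + slack R t1 S) / 2 <=
  slack R (Query i t0 t1) S + slack R (Query i t0 t1) (i |: S).
Proof.
move=> irr iS; have [_ _ irr0 irr1] := irr.
have l9 : 0 <= ln 9 :> R by apply: ln_ge0; lra.
have iSN0 : (i |: S == set0) = false.
  by apply/negbTE/set0Pn; exists i; rewrite setU11.
rewrite /slack iSN0; have [S0|SN0] := eqVneq S set0.
  rewrite addr0 mul0r add0r mulr_ge0 ?sqr_ge0 // path_weight_queryU1 //.
  rewrite S0 !path_weight_set0 eqxx !addr0 setU0 cards1 ln_div ?posrE ?ltr0n // ln1.
  (* Here the walk encodes a singleton and stops at once. Its potential is 2 - 2 + [max_count], at
     least 1, enough for the single step. *)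
  have : (1 : R) <= (max_count (Query i t0 t1) [set i])%:R.
    by rewrite ler1n /max_count big_set1 /= eqxx.
  by move=> /(ler_wpM2l l9); lra.
have [-> ->] := fourier_query R n i t0 t1 S irr iS.
rewrite path_weight_queryU1 // path_weight_query // (negPf SN0) add0r cardsU1 iS add1n.
rewrite -(natr1 #|S|).
have cA := @path_weight_gt0 R n t0 S irr0 SN0; have cB := @path_weight_gt0 R n t1 S irr1 SN0.
have mAB := @max_count_drop R n i t0 t1 S SN0.
have mU : ((max_count (Query i t0 t1) S)%:R : R) <=
    (max_count (Query i t0 t1) (i |: S))%:R.
  by rewrite ler_nat /max_count big_setU1 //= leq_maxr.
have [] := max_count_child n i t0 t1 S.
rewrite -!(ler_nat R).
have cA0 := path_weight_ge0 R n t0 S; have cB0 := path_weight_ge0 R n t1 S.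
move: cA cB mAB mU cA0 cB0.
set A := fourier _ _ _; set B := fourier _ _ _.
set c0 := path_weight _ _ _; set c1 := path_weight _ _ _.
set s : R := #|S|%:R.
set k := max_count (Query i t0 t1) S; set k' := max_count _ (i |: S).
set k0 := max_count t0 S; set k1 := max_count t1 S.
move=> cA cB mAB mU cA0 cB0 mA mB.
have hA : A ^+ 2 * (ln c0 - ln 9) <= A ^+ 2 * ln ((c0 + c1) / 9).
  have [->|/cA c0_gt0] := eqVneq A 0; first by rewrite expr0n !mul0r.
  have c_gt0 : 0 < c0 + c1 by lra.
  rewrite ler_wpM2l ?sqr_ge0 // ln_div ?posrE ?ltr0n // lerD2r.
  by rewrite ler_ln ?posrE //; lra.
have hB : B ^+ 2 * (ln c1 - ln 9) <= B ^+ 2 * ln ((c0 + c1) / 9).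
  have [->|/cB c1_gt0] := eqVneq B 0; first by rewrite expr0n !mul0r.
  have c_gt0 : 0 < c0 + c1 by lra.
  rewrite ler_wpM2l ?sqr_ge0 // ln_div ?posrE ?ltr0n // lerD2r.
  by rewrite ler_ln ?posrE //; lra.
have hU : 0 <= ln 9 * (((A - B) / 2) ^+ 2 * (k'%:R - k%:R)).
  by rewrite mulr_ge0 // mulr_ge0 ?sqr_ge0 // subr_ge0.
(* The two terms -1 are the cost of the step. If [A] or [B] vanishes, (A - B)^2, the gain from [i]
   joining S, pays it; otherwise the drop in [max_count] does. *)
suff hK : 0 <= ln 9 * (A ^+ 2 * (k%:R - k0%:R - 1) +
    B ^+ 2 * (k%:R - k1%:R - 1) + (A - B) ^+ 2) by lra.
rewrite mulr_ge0 //.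
have [A0|AN0] := eqVneq A 0.
  have : 0 <= B ^+ 2 * (k%:R - k1%:R) by rewrite mulr_ge0 ?sqr_ge0 //; lra.
  by rewrite A0; lra.
have [B0|BN0] := eqVneq B 0.
  have : 0 <= A ^+ 2 * (k%:R - k0%:R) by rewrite mulr_ge0 ?sqr_ge0 //; lra.
  by rewrite B0; lra.
have [] := mAB AN0 BN0.
rewrite -!(ler_nat R) -(natr1 k0) -(natr1 k1) => h0 h1.
by rewrite !addr_ge0 ?sqr_ge0 // mulr_ge0 ?sqr_ge0 //; lra.
Qed.

(** It bounds the expected code length -ln [path_weight] by [ln 9] times the expected potential. At
    a leaf nonempty sets have no mass; at a query, sets containing [i] have none in the children. *)
Lemma sum_slack_ge0 (R : realType) (n : nat) (t : dtree n) :
  irredundant t -> 0 <= \sum_S slack R t S.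
Proof.
elim: t => [b _|i t0 IH0 t1 IH1 irr].
  apply: sumr_ge0 => S _; rewrite /slack; case: eqVneq => // /set0Pn[j jS].
  by rewrite (fourier_support R n (Leaf n b) j) // expr0n mul0r.
have [c0 c1 /IH0 {}IH0 /IH1 {}IH1] := irr.
rewrite (big_set_split _ _ i).
apply: (@le_trans _ _ (\sum_(S : {set 'I_n} | i \notin S)
    (slack R t0 S + slack R t1 S) / 2)); last first.
  by apply: ler_sum => S; apply: slack_query.
suff -> : \sum_(S : {set 'I_n} | i \notin S) (slack R t0 S + slack R t1 S) / 2 =
    (\sum_S slack R t0 S + \sum_S slack R t1 S) / 2.
  by lra.
rewrite -big_split -mulr_suml /= [in RHS](big_set_split _ _ i).
congr (_ / _); apply: eq_bigr => S iS.
rewrite [X in _ = _ + X](_ : _ = 0) ?addr0 // /slack; case: eqP => // _.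
  by rewrite addr0.
rewrite (fourier_support R n t0 i) ?setU11 //.
by rewrite (fourier_support R n t1 i) ?setU11 // expr0n !mul0r addr0.
Qed.

(** * Assembling the entropy bound *)

(** Stated in natural logarithms, hence the factor [ln 2]. [V] is the probability that S is
    nonempty: [hV] bounds the entropy of that event, [hcode] the remaining code length. *)
Lemma entropy_le (R : realType) (n k : nat) (t : dtree n) :
  irredundant t -> read_k k t ->
  \sum_S fourier R (dtree_eval t) S ^+ 2 * ln (1 / fourier R (dtree_eval t) S ^+ 2)
  <= (2 * ln 2 + (2 * k%:R + 2) * ln 3) * total_influence R (dtree_eval t).
Proof.
move=> irr rk; set F := fourier R (dtree_eval t).
set I := total_influence R _; set V := 1 - F set0 ^+ 2.
have sumV : \sum_(S | S != set0) F S ^+ 2 = V.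
  have := sum_fourier_sqr R n (dtree_eval t); rewrite -/F (bigD1 set0) //= => h.
  by rewrite /V -h [X in X - _]addrC addrK.
have V0 : 0 <= V by rewrite -sumV; apply: sumr_ge0 => S _; apply: sqr_ge0.
have hVF S : S != set0 -> F S ^+ 2 <= V.
  move=> SN0; rewrite -sumV (bigD1 S) //= lerDl.
  by apply: sumr_ge0 => ? _; apply: sqr_ge0.
have hV : - (V * ln V) - F set0 ^+ 2 * ln (F set0 ^+ 2) <= 2 * ln 2 * I.
  have iso e := edge_isoperimetric R n t e irr.
  have := fourier_le1 R n (dtree_eval t) set0; rewrite ler_norml => /andP[m0 m1].
  rewrite -/F in m0 m1 iso.
  (* The sign of the mean tells which value is rarer; isoperimetry is applied to that value, so that
     2b <= 1. *)
  have [F0|F0] := leP 0 (F set0).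
    have := iso true; rewrite /= !pm1E; set b := (1 + _) / 2.
    have Fb : F set0 = 1 - 2 * b by rewrite /b; field.
    have := binary_entropy_le R b; rewrite -Fb -/V -/I; lra.
  have := iso false; rewrite /= !pm1E; set b := (1 + _) / 2.
  have Fb : - F set0 = 1 - 2 * b by rewrite /b; field.
  have := binary_entropy_le R b; rewrite -Fb sqrrN -/V -/I; lra.
(* The weights are rescaled by [V] to match the total mass of the nonempty sets. *)
have gibbs S : S != set0 -> F S ^+ 2 * ln (1 / F S ^+ 2) <=
    - (F S ^+ 2 * ln V) - F S ^+ 2 * ln (path_weight R t S) + V * path_weight R t S - F S ^+ 2.
  move=> SN0; have [F0|FN0] := eqVneq (F S) 0.
    have := mulr_ge0 V0 (path_weight_ge0 R n t S).
    by rewrite F0 expr0n /= !mul0r; lra.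
  have c0 := path_weight_gt0 R n t S irr SN0 FN0.
  have F2 : 0 < F S ^+ 2 by rewrite lt_def sqr_ge0 expf_neq0.
  have V1 : 0 < V by apply: lt_le_trans F2 (hVF S SN0).
  have := @mul_ln_le R (F S ^+ 2) (V * path_weight R t S) (ltW F2)
    (mulr_ge0 V0 (ltW c0)) (fun _ => mulr_gt0 V1 c0).
  rewrite lnM ?posrE // div1r lnV ?posrE //; lra.
have hcode : - \sum_(S | S != set0) F S ^+ 2 * ln (path_weight R t S) <=
    (2 * k%:R + 2) * ln 3 * I.
  have := sum_slack_ge0 R n t irr.
  rewrite (bigD1 set0) //= {1}/slack eqxx add0r => h.
  suff : \sum_(S | S != set0) slack R t S <= (2 * k%:R + 2) * ln 3 * I +
      \sum_(S | S != set0) F S ^+ 2 * ln (path_weight R t S) by lra.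
  rewrite /I /total_influence [X in _ * X](bigD1 set0) //= cards0 mul0r add0r.
  rewrite mulr_sumr -big_split; apply: ler_sum => S SN0 /=.
  rewrite /slack (negPf SN0) -/(F S) mulrDr lerD2r.
  have -> : ln 9 = 2 * ln 3 :> R.
    have -> : (9 : R) = 3 ^+ 2 by ring.
    by rewrite lnXn ?ltr0n // mulr_natl.
  have [->|FN0] := eqVneq (F S) 0; first by rewrite expr0n mul0r !mulr0.
  have l3 : 0 <= ln 3 :> R by apply: ln_ge0; lra.
  (* This gives k >= 1. Then 2|S| - 2 + k <= (k + 1)|S|, because the difference is (|S| - 1)(k - 1)
     + 1. *)
  have K1 : (1 : R) <= (max_count t S)%:R by rewrite ler1n (max_count_gt0 R).
  have Kk : (max_count t S)%:R <= k%:R :> R.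
    by rewrite ler_nat; apply/bigmax_leqP => j _; apply: rk.
  have s1 : (1 : R) <= #|S|%:R by rewrite ler1n card_gt0.
  have sk : 0 <= (#|S|%:R - 1) * (k%:R - 1) :> R by rewrite mulr_ge0; lra.
  have : 0 <= F S ^+ 2 * ln 3 *
      ((k%:R + 1) * #|S|%:R - (2 * #|S|%:R - 2 + (max_count t S)%:R)).
    by apply: mulr_ge0; [rewrite mulr_ge0 ?sqr_ge0 | lra].
  lra.
rewrite (bigD1 set0) //=.
have hgibbs : \sum_(S | S != set0) F S ^+ 2 * ln (1 / F S ^+ 2) <=
    - (V * ln V) - \sum_(S | S != set0) F S ^+ 2 * ln (path_weight R t S)
    + V * \sum_(S | S != set0) path_weight R t S - V.
  apply: le_trans (ler_sum _ gibbs) _.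
  by rewrite sumrB big_split /= sumrB sumrN -mulr_suml -mulr_sumr sumV.
have cV : V * \sum_(S | S != set0) path_weight R t S <= V.
  rewrite -[leRHS]mulr1 ler_wpM2l //; have := sum_path_weight_le1 R n t.
  by rewrite (bigD1 set0) //= path_weight_set0 add0r.
have -> : F set0 ^+ 2 * ln (1 / F set0 ^+ 2) = - (F set0 ^+ 2 * ln (F set0 ^+ 2)).
  have [->|F0] := eqVneq (F set0) 0; first by rewrite expr0n !mul0r oppr0.
  by rewrite div1r lnV ?mulrN // posrE lt_def sqr_ge0 expf_neq0.
lra.
Qed.

Theorem theorem2p8 (R : realType) (n k : nat) (f : cube n -> bool)
    (hf : exists t : dtree n, read_k k t /\ computes t f)
    (d : measure_display) (T : measurableType d) (P : probability T R)
    (X : T -> {set 'I_n}) (hX : spectral_sample P f X) :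
  entropy P X <= (2 + (2 * k%:R + 2) * log2 (3 : R)) * total_influence R f.
Proof.
have [t [rk tf]] := hf; have [_ hF] := hX.
pose t' := prune (fun=> None) t.
have fE : f = dtree_eval t'.
  by apply/funext => x; rewrite -tf prune_eval.
have rk' : read_k k t'.
  by move=> i; apply: leq_trans (rk i); apply: prune_count_le.
have l2 : 0 < ln 2 :> R by have := ln2_ge_half R; lra.
have := entropy_le R n k t' (prune_irredundant n t _) rk'.
rewrite -fE => h.
(* Multiplying by [ln 2] turns bits into natural units. *)
rewrite -(ler_pM2r l2) /entropy mulr_suml; apply: le_trans (le_trans h _).
  apply: ler_sum => S _; rewrite hF /log2 -mulrA divfK //.
  by rewrite gt_eqF.
rewrite le_eqVlt; apply/orP; left; apply/eqP; rewrite /log2; field.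
by rewrite gt_eqF.
Qed.
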